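(* Let $X$ be a nonnegative random variable with finite moments $m_k=\mathbf{E}[X^k]$, $k=1,2,\ldots$, and $m_1>0$, such that $m_{k+1}/m_k=\mathcal{O}((k+1)^2)$ as $k\to\infty$. Then $X$ satisfies Hardy's condition, i.e., $\mathbf{E}[\exp(c\sqrt{X})]<\infty$ for some constant $c>0$, and $X$ is M-det.
   Context: A nonnegative random variable with all moments finite is called M-det (moment determinate, in the sense of the Stieltjes moment problem) if its distribution is the only probability distribution on $[0,\infty)$ having its moment sequence. *)

(* Defs.v *)
From HB Require Import structures.
From mathcomp Require Import all_boot all_order all_algebra.
From mathcomp Require Import all_classical all_reals all_analysis.

Set Implicit Arguments.
Unset Strict Implicit.
Unset Printing Implicit Defensive.

Import Order.TTheory GRing.Theory Num.Theory.
Import numFieldNormedType.Exports.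

Local Open Scope classical_set_scope.
Local Open Scope ring_scope.

Definition moment (d : measure_display) (T : measurableType d) (R : realType)
    (P : probability T R) (X : {RV P >-> R}) (k : nat) : \bar R :=
  'E_P[fun w => (X w ^+ k)%R]%E.

Definition hardy_condition (d : measure_display) (T : measurableType d)
    (R : realType) (P : probability T R) (X : {RV P >-> R}) : Prop :=
  exists c : R, 0 < c /\
    ('E_P[fun w => expR (c * Num.sqrt (X w))%R] < +oo)%E.

(* Moment determinacy in the Stieltjes sense, meant for [X] nonnegative with
   finite moments. A probability on [0, +oo[ is encoded as a Borel probability
   on the line giving mass 1 to [0, +oo[; two such probabilities are identified
   when they agree on Borel sets, since nothing constrains a measure on
   non-measurable sets. *)
Definition m_det (d : measure_display) (T : measurableType d) (R : realType)
    (P : probability T R) (X : {RV P >-> R}) : Prop :=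
  forall nu : probability R R,
    nu `[0%R, +oo[%classic = 1%E ->
    (forall k : nat, (1 <= k)%N ->
      (\int[nu]_y (y ^+ k)%:E)%E = moment X k) ->
    forall A : set R, measurable A ->
      nu A = distribution P X A.

(* Main.v *)
Require Import Defs.
From HB Require Import structures.
From mathcomp Require Import all_boot all_order all_algebra.
From mathcomp Require Import all_classical all_reals all_analysis.
From mathcomp Require Import measurable_realfun zify ring lra.

Import Order.TTheory GRing.Theory Num.Theory.
Import numFieldNormedType.Exports.

Local Open Scope classical_set_scope.
Local Open Scope ring_scope.

(** Write [Z] for the square root of [X].  The growth of the moments gives
    [m_k <= A B^(2k) (2k)!], so the even moments of [Z] are at most,
    up to a constant, those of an exponential law, and the cosh series shows
    that [exp (c Z)] is integrable for small [c]
    ([factorial_bound_of_growth], [integrable_expR_of_moments]).  This is Hardy's condition, and it holds for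
    every law on the half-line with the same moments.

    Let [mu] and [nu] be two such laws.  The [m_k] are the even moments of [Z],
    which are the Taylor coefficients at [0] of [t |-> E cos (t Z)].  The
    exponential moment makes this function analytic with a radius of
    convergence bounded below uniformly in [t]; hence equality of all its
    derivatives, under [mu] and under [nu], propagates from [0] to the whole
    line by steps of length [c / 2] ([same_trig_momentsD],
    [same_trig_moments_all]).

    No inversion formula is then needed.  Call a bounded function [u]
    determined when all its powers have the same integral under [mu] and [nu]
    ([same_powers]).  Determined functions are stable under scaling, bounded
    pointwise limits and the exponential.  The functions [cos (t Z)] are
    determined by the product-to-sum formula, and two exponentials with two
    limits lead from them to indicator functions of rays:
    - [exp (- s Z^2)] is the limit of [exp (- 2 s (1 - cos (t Z)) / t^2)] as
      [t] tends to [0] ([same_powers_gauss]);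
    - the indicator function of [a < Z^2] is the limit of
      [exp (- n exp (- n (Z^2 - a)))] ([same_integral_indic]).
    As [Z^2 = X], the two laws agree on rays, hence on Borel sets
    ([eq_law_of_moments]). *)

(** * Series and limits of elementary functions *)

Section ElementaryFunctions.
Context {R : realType}.

Lemma norm_series_exp_coeff_le (x : R) (n : nat) :
  `|series (exp_coeff x) n| <= expR `|x|.
Proof.
apply: le_trans (ler_norm_sum _ _ _) _.
rewrite (eq_bigr (exp_coeff `|x|)); last first.
  by move=> i _; rewrite /exp_coeff/= normrM normfV normrX normr_nat.
apply: nondecreasing_cvgn_le (is_cvg_series_exp_coeff _) n.
apply/nondecreasing_seqP => k; rewrite /series/= big_nat_recr//= lerDl.
exact: exp_coeff_ge0.
Qed.

Lemma exprn_le_fact_expR (y : R) (n : nat) :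
  0 <= y -> y ^+ n <= n`!%:R * expR y.
Proof.
move=> y0; rewrite mulrC -ler_pdivrMr ?ltr0n ?fact_gt0//.
case: n => [|n]; first by rewrite expr0 divr1 -expR0 ler_expR.
by apply: le_trans (expR_ge1Dxn n y0); rewrite lerDr.
Qed.

(** Only the even terms survive: this is twice a partial sum of cosh, which
    brings in the even powers of [w] alone. *)
Lemma series_exp_coeff_even (w : R) (n : nat) :
  series (exp_coeff w) n.*2 + series (exp_coeff (- w)) n.*2 =
  \sum_(0 <= k < n) 2 * (w ^+ k.*2 / k.*2`!%:R).
Proof.
elim: n => [|n IH]; first by rewrite /series/= !big_geq// addr0.
have even_term : exp_coeff (- w) n.*2 = exp_coeff w n.*2.
  by rewrite /exp_coeff/= exprNn -signr_odd odd_double mul1r.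
have odd_term : exp_coeff (- w) n.*2.+1 = - exp_coeff w n.*2.+1.
  by rewrite /exp_coeff/= exprNn -signr_odd/= odd_double/= expr1 mulN1r mulNr.
rewrite big_nat_recr// -IH doubleS /series/= !big_nat_recr//= even_term odd_term.
rewrite -[w ^+ _ / _]/(exp_coeff w n.*2).
by move: (exp_coeff _ _) (exp_coeff _ _) => e o; ring.
Qed.

Lemma sum_expr4_le (n : nat) :
  \sum_(0 <= k < n) 2 * 4^-1 ^+ k <= (4 : R).
Proof.
suff : \sum_(0 <= k < n) 2 * 4^-1 ^+ k <= 4 - 4 * 4^-1 ^+ n :> R.
  by move/le_trans; apply; rewrite gerBl mulr_ge0// exprn_ge0// invr_ge0.
elim: n => [|n IH]; first by rewrite big_geq// expr0 mulr1 subrr.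
rewrite big_nat_recr//= exprS.
have : 0 <= (4^-1 : R) ^+ n by rewrite exprn_ge0// invr_ge0.
by move: IH; lra.
Qed.

Lemma norm_cos_coeff_le (h : R) (n : nat) : `|cos_coeff h n| <= `|h| ^+ n / n`!%:R.
Proof.
rewrite cos_coeffE !normrM normfV !normrX normrN1 expr1n mulr1 !normr_nat mulrC.
by apply: ler_wpM2l; rewrite ?exprn_ge0// ler_piMl// lern1 leq_b1.
Qed.

Lemma norm_sin_coeff_le (h : R) (n : nat) : `|sin_coeff h n| <= `|h| ^+ n / n`!%:R.
Proof.
rewrite sin_coeffE !normrM normfV !normrX normrN1 expr1n mulr1 !normr_nat mulrC.
by apply: ler_wpM2l; rewrite ?exprn_ge0// ler_piMl// lern1 leq_b1.
Qed.

Lemma cos_coeffMr (h y : R) (n : nat) :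
  cos_coeff (h * y) n = cos_coeff h n * y ^+ n.
Proof. by rewrite !cos_coeffE exprMn mulrA. Qed.

Lemma sin_coeffMr (h y : R) (n : nat) :
  sin_coeff (h * y) n = sin_coeff h n * y ^+ n.
Proof. by rewrite !sin_coeffE exprMn mulrA. Qed.

Lemma cvg_mulrn_sin (y : R) :
  n.+1%:R * sin (y / n.+1%:R) @[n --> \oo] --> y.
Proof.
have [->|y0] := eqVneq y 0.
  rewrite [X in X @ _ --> _](_ : _ = fun=> 0); first exact: cvg_cst.
  by apply/funext => n; rewrite mul0r sin0 mulr0.
have sin_dnbhs : h^-1 * sin h @[h --> (0 : R)^'] --> (1 : R).
  have dsin : is_derive (0 : R) 1 sin (cos 0) by exact: is_derive_sin.
  have := @derive_val _ _ _ _ _ _ _ dsin; rewrite cos0 => <-.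
  have := @ex_derive _ _ _ _ _ _ _ dsin; rewrite /derivable /derive.
  suff -> : (fun h : R => h^-1 *: ((sin \o shift 0) (h *: (1 : R)) - sin 0)) =
            (fun h : R => h^-1 * sin h) by [].
  by apply/funext => h; rewrite /= sin0 subr0 addr0 /GRing.scale/= mulr1.
have hn : (forall n, y / n.+1%:R != 0) /\ y / n.+1%:R @[n --> \oo] --> 0.
  split=> [n|]; first by rewrite mulf_neq0// invr_eq0 pnatr_eq0.
  by rewrite -[X in _ --> X](mulr0 y); apply: cvgM (cvg_cst _) cvg_harmonic.
have := (cvgr_dnbhsP (fun h : R => h^-1 * sin h) 0 1).1 sin_dnbhs _ hn.
move=> sy; rewrite -[X in _ --> X](mulr1 y).
rewrite [X in X @ _ --> _](_ : _ =
    fun n => y * ((y / n.+1%:R)^-1 * sin (y / n.+1%:R))).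
  exact: cvgM (cvg_cst _) sy.
by apply/funext => n; rewrite invf_div mulrA [in RHS](mulrC y (_ / y)) divfK.
Qed.

Lemma cvg_mulrn_expRN (b : R) : 0 < b ->
  n%:R * expR (- (n%:R * b)) @[n --> \oo] --> (0 : R).
Proof.
move=> b0.
have h0 : 2 / b ^+ 2 * n%:R^-1 @[n --> \oo] --> (0 : R).
  rewrite -[X in _ --> X](mulr0 (2 / b ^+ 2)); apply: cvgM (cvg_cst _) _.
  rewrite -cvg_shiftS; exact: cvg_harmonic.
apply: squeeze_cvgr (cvg_cst 0) h0; apply: nearW => n.
rewrite mulr_ge0 ?expR_ge0//=; case: n => [|n]; first by rewrite mul0r invr0 mulr0.
have nb : 0 < n.+1%:R * b by rewrite mulr_gt0.
have := exprn_le_fact_expR _ 2 (ltW nb).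
rewrite expRN -mulrA -invfM ler_pdivrMr ?expR_gt0// => H.
rewrite mulrAC ler_pdivlMr ?mulr_gt0 ?exprn_gt0//.
by move: H; rewrite !exprMn (_ : 2`! = 2%N)// !expr2; lra.
Qed.

End ElementaryFunctions.

(** * Functions with the same integral under two laws *)

Section SameIntegral.
Context {d : measure_display} {T : measurableType d} {R : realType}.
Context (mu nu : probability T R).

Definition same_integral (f : T -> R) : Prop :=
  [/\ mu.-integrable setT (EFin \o f), nu.-integrable setT (EFin \o f) &
      \int[mu]_x (f x)%:E = \int[nu]_x (f x)%:E]%E.

Lemma same_integral_measurable (f : T -> R) :
  same_integral f -> measurable_fun setT f.
Proof. by case=> /integrableP[mf _] _ _; exact/measurable_EFinP. Qed.

Lemma eq_same_integral (f g : T -> R) :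
  f =1 g -> same_integral f -> same_integral g.
Proof. by move=> /funext->. Qed.

Lemma same_integral_cst (c : R) : same_integral (fun=> c).
Proof.
split; [exact: finite_measure_integrable_cst|exact: finite_measure_integrable_cst|].
by rewrite !integral_cst//= !probability_setT.
Qed.

Lemma same_integralZ (c : R) (f : T -> R) :
  same_integral f -> same_integral (fun x => c * f x).
Proof.
move=> [f1 f2 f12]; split.
- by have := integrableZl measurableT c f1.
- by have := integrableZl measurableT c f2.
- under eq_integral do rewrite EFinM.
  under [RHS]eq_integral do rewrite EFinM.
  by rewrite (integralZl measurableT f1) (integralZl measurableT f2) f12.
Qed.

Lemma same_integralD (f g : T -> R) :
  same_integral f -> same_integral g -> same_integral (fun x => f x + g x).
Proof.
move=> [f1 f2 f12] [g1 g2 g12]; split.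
- by have := integrableD measurableT f1 g1.
- by have := integrableD measurableT f2 g2.
- under eq_integral do rewrite EFinD.
  under [RHS]eq_integral do rewrite EFinD.
  rewrite (integralD_EFin measurableT f1 g1).
  by rewrite (integralD_EFin measurableT f2 g2) f12 g12.
Qed.

Lemma same_integral_series (f_ : nat -> T -> R) (n : nat) :
  (forall i, same_integral (f_ i)) ->
  same_integral (fun x => series (f_ ^~ x) n).
Proof.
move=> sf; elim: n => [|n IH].
  apply: eq_same_integral (same_integral_cst 0) => x.
  by rewrite /series/= big_geq.
apply: eq_same_integral (same_integralD _ _ IH (sf n)) => x.
by rewrite /series/= big_nat_recr.
Qed.

(** Dominated convergence, applied under both laws. *)
Lemma same_integral_cvg (f_ : nat -> T -> R) (f g : T -> R) :
  mu.-integrable setT (EFin \o g) -> nu.-integrable setT (EFin \o g) ->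
  (forall n, same_integral (f_ n)) ->
  (forall n x, `|f_ n x| <= g x) ->
  (forall x, f_ ^~ x @ \oo --> f x) ->
  same_integral f.
Proof.
move=> g1 g2 sf_ fg f_f.
have mf_ n : measurable_fun setT (EFin \o f_ n).
  exact/measurable_EFinP/same_integral_measurable.
have mf : measurable_fun setT (EFin \o f).
  apply/measurable_EFinP; apply: measurable_fun_cvg (fun x _ => f_f x) => n.
  exact: same_integral_measurable.
have cvE x : (EFin \o f_ ^~ x) @ \oo --> (EFin \o f) x.
  exact: cvg_comp (f_f x) _.
have dom n x : (`|(EFin \o f_ n) x| <= (EFin \o g) x)%E by rewrite lee_fin.
have DC (P : probability T R) : P.-integrable setT (EFin \o g) ->
    P.-integrable setT (EFin \o f) /\
    (\int[P]_x (f_ n x)%:E @[n --> \oo] --> \int[P]_x (f x)%:E)%E.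
  move=> gP.
  have [] := @dominated_convergence _ _ _ P _ measurableT
    (fun n => EFin \o f_ n) (EFin \o f) (EFin \o g) mf_ mf _ gP _ => //.
  - by apply: aeW => x _; exact: cvE.
  - by apply: aeW => x n _; exact: dom.
have [f1 c1] := DC mu g1; have [f2 c2] := DC nu g2.
split => //; apply: cvg_unique c1 _ => //.
by rewrite (_ : (fun n => _) = (fun n => \int[nu]_x (f_ n x)%:E)%E)//;
  apply/funext => n; case: (sf_ n).
Qed.

End SameIntegral.

(** * Bounded functions with the same moments under two laws *)

Section SamePowers.
Context {d : measure_display} {T : measurableType d} {R : realType}.
Context (mu nu : probability T R).

(** Asking for every power, and not only for [u], is what makes the notion
    stable under the exponential. *)
Definition same_powers (u : T -> R) : Prop :=
  forall n, same_integral mu nu (fun x => u x ^+ n).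

Lemma same_powersZ (c : R) (u : T -> R) :
  same_powers u -> same_powers (fun x => c * u x).
Proof.
move=> su n.
apply: eq_same_integral (same_integralZ _ _ (c ^+ n) _ (su n)) => x.
by rewrite exprMn.
Qed.

Lemma same_integral_bounded_cvg (M : R) (f_ : nat -> T -> R) (f : T -> R) :
  (forall n, same_integral mu nu (f_ n)) ->
  (forall n x, `|f_ n x| <= M) ->
  (forall x, f_ ^~ x @ \oo --> f x) ->
  same_integral mu nu f.
Proof.
move=> sf fM cf; apply: (@same_integral_cvg _ _ _ mu nu f_ f (fun=> M)) => //;
  exact: finite_measure_integrable_cst.
Qed.

Lemma same_powers_cvg (M : R) (u_ : nat -> T -> R) (u : T -> R) :
  (forall n, same_powers (u_ n)) ->
  (forall n x, `|u_ n x| <= M) ->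
  (forall x, u_ ^~ x @ \oo --> u x) ->
  same_powers u.
Proof.
move=> su uM cu k.
apply: (@same_integral_bounded_cvg (M ^+ k) (fun n x => u_ n x ^+ k)) => [n|n x|x].
- exact: su.
- rewrite normrX; apply: lerXn2r => //; rewrite nnegrE//.
  exact: le_trans (uM n x).
- exact: (cvg_comp _ _ (cu x) (@exprn_continuous R k (u x))).
Qed.

Lemma same_integral_expR (M : R) (u : T -> R) :
  same_powers u -> (forall x, `|u x| <= M) ->
  same_integral mu nu (fun x => expR (u x)).
Proof.
move=> su uM.
apply: (@same_integral_bounded_cvg (expR M)
         (fun n x => series (exp_coeff (u x)) n)) => [n|n x|x].
- apply: same_integral_series => i.
  by apply: eq_same_integral (same_integralZ _ _ (i`!%:R^-1) _ (su i)) => x;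
    rewrite mulrC.
- by apply: le_trans (norm_series_exp_coeff_le _ _) _; rewrite ler_expR.
- exact: is_cvg_series_exp_coeff.
Qed.

(** A power of [expR u] is again an exponential, that of a multiple of [u]. *)
Lemma same_powers_expR (M : R) (u : T -> R) :
  same_powers u -> (forall x, `|u x| <= M) ->
  same_powers (fun x => expR (u x)).
Proof.
move=> su uM n.
have bd x : `|n%:R * u x| <= n%:R * M by rewrite normrM normr_nat ler_wpM2l.
apply: eq_same_integral (same_integral_expR _ _ (same_powersZ n%:R _ su) bd) => x.
by rewrite expRM_natl.
Qed.

End SamePowers.

(** * Determinacy of the cosine transform *)

Section CosineTransform.
Context {d : measure_display} {T : measurableType d} {R : realType}.
Context (mu nu : probability T R) (z : T -> R) (c : R).
Hypotheses (z_ge0 : forall x, 0 <= z x) (c_gt0 : 0 < c).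
Hypothesis mu_exp : mu.-integrable setT (fun x => (expR (c * z x))%:E).
Hypothesis nu_exp : nu.-integrable setT (fun x => (expR (c * z x))%:E).

(** Termwise integration of [G x = \sum_n a n * z x ^+ n] against [F].  As
    [z ^+ m] is at most a multiple of [expR (c / 2 * z)], the partial sums times
    [F] are dominated by a multiple of [expR (c * z)] as long as [`|h|] is at
    most [c / 2]: half of the exponent pays for the series and half for [F]. *)
Lemma same_integral_power_series (a : nat -> R) (h : R) (m : nat)
    (F G : T -> R) :
  `|h| <= c / 2 -> (forall n, `|a n| <= `|h| ^+ n / n`!%:R) ->
  (forall x, `|F x| <= z x ^+ m) ->
  (forall n, same_integral mu nu (fun x => a n * (z x ^+ n * F x))) ->
  (forall x, series (fun n => a n * z x ^+ n) @ \oo --> G x) ->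
  same_integral mu nu (fun x => G x * F x).
Proof.
move=> hc ah Fz sF cG.
pose K : R := m`!%:R * (c / 2) ^- m.
have c2 : 0 < c / 2 by rewrite divr_gt0.
apply: (@same_integral_cvg _ _ _ mu nu
  (fun n x => series (fun i => a i * (z x ^+ i * F x)) n) _
  (fun x => K * expR (c * z x))).
- by have := integrableZl measurableT K mu_exp.
- by have := integrableZl measurableT K nu_exp.
- by move=> n; exact: same_integral_series.
- move=> n x.
  have -> : series (fun i => a i * (z x ^+ i * F x)) n =
            series (fun i => a i * z x ^+ i) n * F x.
    by rewrite /series/= mulr_suml; apply: eq_bigr => i _; rewrite mulrA.
  have le1 : `|series (fun i => a i * z x ^+ i) n| <= expR (c / 2 * z x).
    apply: le_trans (_ : series (exp_coeff (`|h| * z x)) n <= _).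
      apply: le_trans (ler_norm_sum _ _ _) _; apply: ler_sum => i _.
      rewrite normrM /exp_coeff/= exprMn normrX (ger0_norm (z_ge0 x)) mulrAC.
      by apply: ler_wpM2r; rewrite ?exprn_ge0.
    apply: le_trans (ler_norm _) _.
    apply: le_trans (norm_series_exp_coeff_le _ _) _.
    by rewrite ler_expR ger0_norm ?mulr_ge0//; apply: ler_wpM2r.
  have le2 : `|F x| <= K * expR (c / 2 * z x).
    apply: le_trans (Fz x) _.
    have /(@exprn_le_fact_expR _ _ m) : 0 <= c / 2 * z x.
      by rewrite mulr_ge0// ltW.
    by rewrite /K exprMn -ler_pdivlMl ?exprn_gt0// mulrA [X in X * expR _]mulrC.
  rewrite normrM (_ : K * _ = expR (c / 2 * z x) * (K * expR (c / 2 * z x))).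
    by apply: ler_pM.
  rewrite mulrCA -expRD; congr (_ * expR _).
  by rewrite -mulrDl -splitr.
- move=> x.
  have -> : (fun n => series (fun i => a i * (z x ^+ i * F x)) n) =
            (fun n => series (fun i => a i * z x ^+ i) n * F x).
    apply/funext => n; rewrite /series/= mulr_suml.
    by apply: eq_bigr => i _; rewrite mulrA.
  exact: cvgM (cG x) (cvg_cst _).
Qed.

(** Up to sign, the [n]-th function is the [n]-th derivative of [cos (t * z)]
    with respect to [t]. *)
Definition same_trig_moments (t : R) : Prop := forall n,
  same_integral mu nu
    (fun x => z x ^+ n * (if odd n then sin (t * z x) else cos (t * z x))).

(** The addition formulas express the functions at [t + h] through
    [cos (h z)] and [sin (h z)], whose power series are integrated termwise
    against the functions at [t].  The parity of the exponent stays tied to the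
    choice between sine and cosine, so every term is known at [t]. *)
Lemma same_trig_momentsD (t h : R) : `|h| <= c / 2 ->
  same_trig_moments t -> same_trig_moments (t + h).
Proof.
move=> hc st n.
pose tr (b : bool) x := if b then sin (t * z x) else cos (t * z x).
pose F b x := z x ^+ n * tr b x.
have F_le b x : `|F b x| <= z x ^+ n.
  rewrite normrM normrX (ger0_norm (z_ge0 x)) ler_piMr ?exprn_ge0//.
  by case: b; rewrite /tr ler_norml ?sin_geN1 ?sin_le1 ?cos_geN1 ?cos_le1.
have cosF : same_integral mu nu (fun x => cos (h * z x) * F (odd n) x).
  apply: (same_integral_power_series (cos_coeff h) h n) => //.
  - exact: norm_cos_coeff_le.
  - move=> i; case oi : (odd i).
      apply: eq_same_integral (same_integral_cst _ _ 0) => x.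
      by rewrite /cos_coeff/= oi !mul0r.
    apply: same_integralZ; apply: eq_same_integral (st (i + n)%N) => x.
    by rewrite /F /tr oddD oi/= exprD mulrA.
  - move=> x; rewrite (_ : (fun _ => _) = cos_coeff (h * z x)).
      by rewrite unlock; exact: is_cvg_series_cos_coeff.
    by apply/funext => i; rewrite cos_coeffMr.
have sinF : same_integral mu nu (fun x => sin (h * z x) * F (~~ odd n) x).
  apply: (same_integral_power_series (sin_coeff h) h n) => //.
  - exact: norm_sin_coeff_le.
  - move=> i; case oi : (odd i); last first.
      apply: eq_same_integral (same_integral_cst _ _ 0) => x.
      by rewrite /sin_coeff/= oi !mul0r.
    apply: same_integralZ; apply: eq_same_integral (st (i + n)%N) => x.
    by rewrite /F /tr oddD oi/= exprD mulrA.
  - move=> x; rewrite (_ : (fun _ => _) = sin_coeff (h * z x)).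
      by rewrite unlock; exact: is_cvg_series_sin_coeff.
    by apply/funext => i; rewrite sin_coeffMr.
have := same_integralD _ _ _ _ cosF (same_integralZ _ _ ((-1) ^+ ~~ odd n) _ sinF).
apply: eq_same_integral => x; rewrite /F /tr mulrDl.
case: (odd n) => /=; rewrite ?sinD ?cosD ?expr0 ?expr1; ring.
Qed.

(** At [t = 0] the sine terms vanish and only even powers of [z] remain; any
    [t] is then reached in finitely many steps of length at most [c / 2]. *)
Lemma same_trig_moments_all :
  (forall k, same_integral mu nu (fun x => z x ^+ k.*2)) ->
  forall t, same_trig_moments t.
Proof.
move=> sz.
have s0 : same_trig_moments 0.
  move=> n; case on : (odd n).
    apply: eq_same_integral (same_integral_cst _ _ 0) => x.
    by rewrite mul0r sin0 mulr0.
  apply: eq_same_integral (sz n./2) => x.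
  by rewrite mul0r cos0 mulr1 even_halfK// on.
move=> t; pose N := (Num.truncn (`|t| / (c / 2))).+1.
have hN : `|t / N%:R| <= c / 2.
  rewrite normrM normfV normr_nat ler_pdivrMr ?ltr0n// mulrC.
  rewrite -ler_pdivrMr ?divr_gt0//.
  exact/ltW/truncnS_gt.
have : forall k, same_trig_moments (k%:R * (t / N%:R)).
  elim=> [|k IH]; first by rewrite mul0r.
  by rewrite -natr1 mulrDl mul1r; exact: same_trig_momentsD.
by move=> /(_ N); rewrite mulrCA divff ?mulr1// pnatr_eq0.
Qed.

(** A power of [cos (t z)] is a combination of the [cos (k t z)]; the induction
    carries an extra factor [cos (s z)] to absorb one cosine at a time. *)
Lemma same_powers_cos :
  (forall k, same_integral mu nu (fun x => z x ^+ k.*2)) ->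
  forall t, same_powers mu nu (fun x => cos (t * z x)).
Proof.
move=> sz t n.
have : forall s, same_integral mu nu (fun x => cos (t * z x) ^+ n * cos (s * z x)).
  elim: n => [s|n IH s].
    apply: eq_same_integral (same_trig_moments_all sz s 0%N) => x.
    by rewrite !expr0.
  have := same_integralZ _ _ (2^-1) _
    (same_integralD _ _ _ _ (IH (t + s)) (IH (t - s))).
  apply: eq_same_integral => x.
  rewrite !mulrDl mulNr cosD cosB exprSr; by field.
by move=> /(_ 0); apply: eq_same_integral => x; rewrite mul0r cos0 mulr1.
Qed.

End CosineTransform.

(** * From the cosine transform to rays *)

Section Laplace.
Context {d : measure_display} {T : measurableType d} {R : realType}.
Context (mu nu : probability T R) (z : T -> R).
Hypothesis scos : forall t, same_powers mu nu (fun x => cos (t * z x)).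

(** [expR (- s z^2)] is approached through bounded functions of the form
    [expR (- 2 s (1 - cos (t z)) / t^2)] with [t = 2 / n.+1]; the half-angle
    formula turns the exponent into [- s (n.+1 sin (z / n.+1))^2], visibly
    nonpositive and convergent. *)
Lemma same_powers_gauss (s : R) : 0 <= s ->
  same_powers mu nu (fun x => expR (- (s * z x ^+ 2))).
Proof.
move=> s0.
pose t n : R := 2 / n.+1%:R.
pose k n : R := s * n.+1%:R ^+ 2 / 2.
have k0 n : 0 <= k n by rewrite !mulr_ge0// exprn_ge0.
pose u n x := expR (- k n) * expR (k n * cos (t n * z x)).
have uE n x : u n x = expR (- (s * (n.+1%:R * sin (z x / n.+1%:R)) ^+ 2)).
  rewrite /u -expRD; congr expR.
  rewrite (_ : t n * z x = (z x / n.+1%:R) *+ 2); last by rewrite mulr2n /t; ring.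
  by rewrite cos_mulr2n cos2sin2 /k mulr2n exprMn; field.
apply: (@same_powers_cvg _ _ _ mu nu 1 u) => [n|n x|x].
- apply: same_powersZ; apply: (@same_powers_expR _ _ _ _ _ (k n)) => [|x].
    exact: same_powersZ.
  by rewrite normrM ger0_norm// ler_piMr// cos_max.
- by rewrite uE ger0_norm ?expR_ge0// -expR0 ler_expR oppr_le0 mulr_ge0// sqr_ge0.
- rewrite (funext (uE ^~ x)).
  have sq := cvg_comp _ _ (cvg_mulrn_sin (z x)) (@exprn_continuous R 2 _).
  have sqs : (fun n => - (s * (n.+1%:R * sin (z x / n.+1%:R)) ^+ 2)) @ \oo
      --> - (s * z x ^+ 2) by exact: cvgN (cvgM (cvg_cst s) sq).
  exact: (cvg_comp _ _ sqs (@continuous_expR R _)).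
Qed.

(** The doubly exponential function [expR (- n expR (- n (z^2 - a)))] tends to
    [1] where [a < z^2] and to [0] elsewhere.  The factor [n] makes the limit
    [0], and not [expR (- 1)], on the level set [z^2 = a]. *)
Lemma same_integral_indic (a : R) :
  same_integral mu nu \1_[set x | a < z x ^+ 2].
Proof.
pose u (n : nat) x := - (n%:R * expR (n%:R * a)) * expR (- (n%:R * z x ^+ 2)).
have uE n x : u n x = - (n%:R * expR (- (n%:R * (z x ^+ 2 - a)))).
  by rewrite /u mulNr -mulrA -expRD mulrBr opprB.
apply: (@same_integral_bounded_cvg _ _ _ mu nu 1 (fun n x => expR (u n x)))
  => [n|n x|x].
- apply: (@same_integral_expR _ _ _ _ _ (n%:R * expR (n%:R * a))) => [|x].
    by apply: same_powersZ; exact: same_powers_gauss.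
  have n0 : 0 <= n%:R * expR (n%:R * a) by rewrite mulr_ge0 ?expR_ge0.
  rewrite normrM normrN (ger0_norm n0) ler_piMr// ger0_norm ?expR_ge0//.
  by rewrite -expR0 ler_expR oppr_le0 mulr_ge0// sqr_ge0.
- by rewrite ger0_norm ?expR_ge0// -expR0 ler_expR uE oppr_le0 mulr_ge0 ?expR_ge0.
- rewrite indicE; under eq_cvg do rewrite uE.
  have [az|za] := ltP a (z x ^+ 2).
    have -> : (x \in [set x | a < z x ^+ 2])%:R = expR 0 :> R.
      by rewrite mem_set// expR0.
    rewrite -subr_gt0 in az.
    have cu : (fun n => - (n%:R * expR (- (n%:R * (z x ^+ 2 - a))))) @ \oo
        --> (- 0 : R) by exact: cvgN (cvg_mulrn_expRN _ az).
    rewrite oppr0 in cu.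
    exact: (cvg_comp _ _ cu (@continuous_expR R _)).
  have -> : (x \in [set x | a < z x ^+ 2])%:R = 0 :> R.
    by rewrite memNset//=; apply/negP; rewrite -leNgt.
  apply: squeeze_cvgr (cvg_cst 0) (@cvgn_expR R); apply: nearW => n.
  rewrite expR_ge0 ler_expR lerN2 ler_peMr//.
  by rewrite -expR0 ler_expR oppr_ge0 mulr_ge0_le0// subr_le0.
Qed.

Lemma eq_measure_sqr_gt (a : R) : measurable [set x | a < z x ^+ 2] ->
  mu [set x | a < z x ^+ 2] = nu [set x | a < z x ^+ 2].
Proof.
move=> mA; have [_ _] := same_integral_indic a.
by rewrite !integral_indic// !setIT.
Qed.

End Laplace.

(** * Exponential moments from moment growth *)

Section ExponentialMoment.
Context {d : measure_display} {T : measurableType d} {R : realType}.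
Context (mu : {measure set T -> \bar R}) (z : T -> R) (A B : R).
Hypotheses (z_ge0 : forall x, 0 <= z x) (mz : measurable_fun setT z).
Hypotheses (A_ge0 : 0 <= A) (B_gt0 : 0 < B).
Hypothesis moment_le : forall k,
  (\int[mu]_x (z x ^+ k.*2)%:E <= (A * B ^+ k.*2 * k.*2`!%:R)%:E)%E.

(** With exponent [z / (2 B)], the [k]-th term of the cosh series has integral
    at most [A / 4 ^+ k]; monotone convergence concludes, since [expR w] is at
    most twice [cosh w]. *)
Lemma integrable_expR_of_moments :
  mu.-integrable setT (fun x => (expR ((2 * B)^-1 * z x))%:E).
Proof.
pose w x := (2 * B)^-1 * z x.
have w_ge0 x : 0 <= w x by rewrite mulr_ge0// invr_ge0 mulr_ge0// ltW.
pose t k x : R := 2 * (w x ^+ k.*2 / k.*2`!%:R).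
have t_ge0 k x : 0 <= t k x by rewrite !mulr_ge0// exprn_ge0.
have mw : measurable_fun setT w by exact: measurable_funM.
have mt k : measurable_fun setT (t k).
  apply: measurable_funM => //; apply: measurable_funM => //.
  exact: measurable_funX.
pose f n x : \bar R := (\sum_(0 <= k < n) (t k x)%:E)%E.
have mf n : measurable_fun setT (f n).
  by apply: emeasurable_sum => k; exact/measurable_EFinP.
have f_ge0 n x : (0 <= f n x)%E by apply: sume_ge0 => k _; rewrite lee_fin.
have f_nd x : nondecreasing_seq (f ^~ x).
  by apply/nondecreasing_seqP => n; rewrite /f big_nat_recr//= leeDl// lee_fin.
have int_t k : (\int[mu]_x (t k x)%:E <= (A * (2 * 4^-1 ^+ k))%:E)%E.
  pose a : R := 2 * (2 * B)^-1 ^+ k.*2 / k.*2`!%:R.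
  have a_ge0 : 0 <= a.
    by rewrite !mulr_ge0// exprn_ge0// invr_ge0 mulr_ge0// ltW.
  have tE x : (t k x)%:E = (a%:E * (z x ^+ k.*2)%:E)%E.
    by rewrite -EFinM /t /w /a exprMn -!mulrA [z x ^+ _ / _]mulrC.
  under eq_integral do rewrite tE.
  rewrite ge0_integralZl_EFin//=; last 2 first.
  - by move=> x _; rewrite lee_fin exprn_ge0.
  - by apply/measurable_EFinP; exact: measurable_funX.
  apply: le_trans (lee_wpmul2l _ (moment_le k)) _; first by rewrite lee_fin.
  rewrite -EFinM lee_fin /a exprVn exprMn -(mul2n k) !exprM.
  rewrite (_ : 2 ^+ 2 = 4 :> R) -?exprVn; last by rewrite expr2; ring.
  have K0 : (2 * k)`!%:R != 0 :> R by rewrite pnatr_eq0 -lt0n fact_gt0.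
  have B0 : (B ^+ 2) ^+ k != 0 by rewrite !expf_neq0// gt_eqF.
  have F0 : (4 : R) ^+ k != 0 by rewrite expf_neq0// pnatr_eq0.
  by rewrite exprVn le_eqVlt; apply/orP; left; apply/eqP; field; rewrite K0 B0 F0.
have int_f n : (\int[mu]_x f n x <= (A * 4)%:E)%E.
  rewrite ge0_integral_sum//; last 2 first.
  - by move=> k; exact/measurable_EFinP.
  - by move=> k x _; rewrite lee_fin.
  apply: le_trans (lee_sum _ (fun k _ => int_t k)) _.
  by rewrite sumEFin lee_fin -mulr_sumr ler_wpM2l// sum_expr4_le.
have cf x : f ^~ x @ \oo --> (expR (w x) + expR (- w x))%:E.
  have c1 (v : R) : series (exp_coeff v) n.*2 @[n --> \oo] --> expR v.
    have dbl : (fun n => n.*2) @ \oo --> \oo.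
      move=> S [N _ NS]; exists N => // n /= Nn; apply: NS => /=.
      by rewrite -addnn (leq_trans Nn)// leq_addr.
    exact: (cvg_comp _ _ dbl (is_cvg_series_exp_coeff v)).
  have -> : f ^~ x = (fun n => (series (exp_coeff (w x)) n.*2 +
                                series (exp_coeff (- w x)) n.*2)%:E).
    by apply/funext => n; rewrite series_exp_coeff_even /f sumEFin.
  exact: (cvg_comp _ _ (cvgD (c1 _) (c1 _))).
have cint := @cvg_monotone_convergence _ _ _ mu _ measurableT f mf
  (fun n x _ => f_ge0 n x) (fun x _ => f_nd x).
have mexpR (v : T -> R) : measurable_fun setT v ->
    measurable_fun setT (fun x => expR (v x)).
  exact: measurableT_comp (@measurable_expR R).
have limE : (fun x => limn (f ^~ x)) = (fun x => (expR (w x) + expR (- w x))%:E).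
  by apply/funext => x; exact: cvg_lim (cf x).
have int_lim : (\int[mu]_x (expR (w x) + expR (- w x))%:E <= (A * 4)%:E)%E.
  rewrite -limE -(cvg_lim _ cint)//; apply: lime_le.
    by apply/cvg_ex; eexists; exact: cint.
  exact: nearW.
apply/integrableP; split; first exact/measurable_EFinP/mexpR.
apply: le_lt_trans (le_trans _ int_lim) (ltry _).
apply: ge0_le_integral => //.
- by apply/measurable_EFinP; apply: measurableT_comp => //; exact: mexpR.
- apply/measurable_EFinP; apply: measurable_funD; apply: mexpR => //.
  exact: measurableT_comp.
- by move=> x _; rewrite lee_fin ger0_norm ?expR_ge0// lerDl expR_ge0.
Qed.

End ExponentialMoment.

(** The factor [(k + 1)^2] of the growth rate is at most
    [(2k + 1) (2k + 2)], the ratio of consecutive even factorials; [A] takes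
    care of the indices up to [N]. *)
Lemma factorial_bound_of_growth (R : realType) (m : nat -> R) (C : R) (N : nat) :
  0 <= C -> (forall k, 0 <= m k) ->
  (forall k, (N <= k)%N -> m k.+1 <= C * k.+1%:R ^+ 2 * m k) ->
  exists A B : R, [/\ 0 <= A, 0 < B &
    forall k, m k <= A * B ^+ k.*2 * k.*2`!%:R].
Proof.
move=> C0 m0 mC; pose A := \sum_(0 <= i < N.+1) m i; pose B := 1 + C.
have A0 : 0 <= A by apply: sumr_ge0.
have B0 : 0 < B by rewrite ltr_wpDr.
have B1 : 1 <= B by rewrite lerDl.
(* [1 + C] serves as [B] since it is at least [1] and its square at least [C]. *)
exists A, B; split=> //.
have small k : (k <= N)%N -> m k <= A * B ^+ k.*2 * k.*2`!%:R.
  move=> kN; apply: le_trans (_ : A <= _).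
    rewrite /A (big_rem k)/=; last by rewrite mem_index_iota ltnS.
    by rewrite lerDl sumr_ge0.
  by rewrite -mulrA ler_peMr// mulr_ege1 ?exprn_ege1// ler1n fact_gt0.
elim=> [|k IH]; first exact: small.
have [kN|Nk] := leqP k.+1 N; first exact: small.
apply: le_trans (mC _ Nk) _.
apply: le_trans (ler_wpM2l _ IH) _; first by rewrite mulr_ge0// sqr_ge0.
have CB : C <= B ^+ 2 by rewrite /B expr2; nra.
rewrite doubleS !factS !exprS !natrM.
set F : R := k.*2`!%:R; set E := B ^+ k.*2.
have F0 : 0 <= F by [].
have E0 : 0 <= E by rewrite exprn_ge0// ltW.
rewrite [leLHS](_ : _ = A * E * F * (C * k.+1%:R ^+ 2)); last by ring.
rewrite [leRHS](_ : _ = A * E * F * (B ^+ 2 * (k.*2.+2%:R * k.*2.+1%:R)));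
  last by ring.
rewrite ler_wpM2l ?mulr_ge0// ler_pM ?sqr_ge0//.
by rewrite expr2 -!natrM ler_nat; lia.
Qed.

(** * Nonnegative variables and their square roots *)

Lemma measurable_set_gt (d : measure_display) (T : measurableType d)
    (R : realType) (f : T -> R) (a : R) :
  measurable_fun setT f -> measurable [set x | a < f x].
Proof.
move=> mf; rewrite [X in measurable X](_ : _ = setT `&` f @^-1` `]a, +oo[).
  exact: mf.
by rewrite setTI; apply/seteqP; split=> x /=; rewrite in_itv/= andbT.
Qed.

Section SquareRoot.
Context {d : measure_display} {T : measurableType d} {R : realType}.
Context (P : probability T R) (Y : T -> R).
Hypotheses (mY : measurable_fun setT Y) (Y_ge0 : {ae P, forall x, 0 <= Y x}).

Lemma measurable_sqrt : measurable_fun setT (fun x => Num.sqrt (Y x)).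
Proof.
apply: measurableT_comp mY; apply: continuous_measurable_fun.
exact: sqrt_continuous.
Qed.

Lemma integral_sqrt_double (k : nat) :
  (\int[P]_x (Num.sqrt (Y x) ^+ k.*2)%:E = \int[P]_x (Y x ^+ k)%:E)%E.
Proof.
apply: ae_eq_integral => //.
- by apply/measurable_EFinP; apply: measurable_funX; exact: measurable_sqrt.
- by apply/measurable_EFinP; exact: measurable_funX.
- apply: filterS Y_ge0 => x Yx _ /=.
  by rewrite -mul2n exprM sqr_sqrtr.
Qed.

Lemma measure_sqrt_gt (a : R) :
  P [set x | a < Num.sqrt (Y x) ^+ 2] = P [set x | a < Y x].
Proof.
have m1 := measurable_set_gt _ _ _ _ a (measurable_funX 2 measurable_sqrt).
have m2 := measurable_set_gt _ _ _ _ a mY.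
rewrite -[X in P X = _]setIT -[X in _ = P X]setIT -!integral_indic//.
apply: ae_eq_integral => //.
- by apply/measurable_EFinP.
- by apply/measurable_EFinP.
- apply: filterS Y_ge0 => x Yx _ /=.
  rewrite !indicE; congr ((nat_of_bool _)%:R%:E).
  by apply/idP/idP; rewrite !inE/= sqr_sqrtr.
Qed.

(** One vanishing moment of positive order forces the variable to vanish almost everywhere.  The
    ratios of consecutive moments thus have nonzero denominators as soon as
    the first moment is positive. *)
Lemma integral_sqrt_eq0 (k : nat) : (0 < k)%N ->
  (\int[P]_x (Num.sqrt (Y x) ^+ k.*2)%:E = 0)%E ->
  forall n, (0 < n)%N -> (\int[P]_x (Num.sqrt (Y x) ^+ n.*2)%:E = 0)%E.
Proof.
move=> k0 intk n n0.
have mz j : measurable_fun setT (fun x => (Num.sqrt (Y x) ^+ j)%:E).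
  by apply/measurable_EFinP; apply: measurable_funX; exact: measurable_sqrt.
have /ae_eq_integral_abs : (\int[P]_x `|(Num.sqrt (Y x) ^+ k.*2)%:E| = 0)%E.
  rewrite -[RHS]intk; apply: eq_integral => x _.
  by rewrite gee0_abs// lee_fin exprn_ge0.
move=> /(_ measurableT (mz _)) z0.
rewrite -[RHS](integral0 P setT); apply: ae_eq_integral => //.
apply: filterS z0 => x /(_ I)[] /eqP; rewrite expf_eq0 double_gt0 k0/= => /eqP sY _.
by rewrite /= sY expr0n double_eq0 -[n == 0%N]negbK -lt0n n0.
Qed.

End SquareRoot.

(** * Moment determinacy *)

Lemma ge0_ae_of_probability (R : realType) (nu : probability R R) :
  nu `[0, +oo[%classic = 1%E -> {ae nu, forall y, 0 <= y}.
Proof.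
move=> nu1; exists (~` `[0, +oo[%classic); split.
- exact: measurableC.
- by rewrite probability_setC// nu1 subee.
- by apply: subsetC => y /=; rewrite in_itv/= andbT.
Qed.

Lemma ge0_ae_distribution (d : measure_display) (T : measurableType d)
    (R : realType) (P : probability T R) (X : {RV P >-> R}) :
  {ae P, forall w, 0 <= X w} -> {ae distribution P X, forall y, 0 <= y}.
Proof.
move=> X0; exists `]-oo, 0[%classic; split => //.
- have mN : measurable (X @^-1` `]-oo, 0[) by exact: measurable_funPTI.
  apply: (measure_negligible mN); apply: negligibleS X0 => w /=.
  by rewrite in_itv/= => Xw; apply/negP; rewrite -ltNge.
- by move=> y /= /negP; rewrite -ltNge in_itv.
Qed.

(** The moment bound, assumed under [mu] only, passes to [nu] because it speaks
    of moments alone; both laws thus have the exponential moment that the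
    cosine transform requires. *)
Lemma eq_law_of_moments (R : realType) (mu nu : probability R R) (A B : R) :
  {ae mu, forall y, 0 <= y} -> {ae nu, forall y, 0 <= y} -> 0 <= A -> 0 < B ->
  (forall k, (\int[mu]_y (y ^+ k)%:E <= (A * B ^+ k.*2 * k.*2`!%:R)%:E)%E) ->
  (forall k, \int[mu]_y (y ^+ k)%:E = \int[nu]_y (y ^+ k)%:E)%E ->
  forall S, measurable S -> mu S = nu S.
Proof.
move=> mu0 nu0 A0 B0 mA eqm.
pose z (y : R) : R := Num.sqrt y.
have mid : measurable_fun setT (fun y : R => y) by exact: measurable_id.
have mz : measurable_fun setT z by exact: measurable_sqrt mid.
have muz k := integral_sqrt_double mu _ mid mu0 k.
have nuz k := integral_sqrt_double nu _ mid nu0 k.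
have z0 y : 0 <= z y by exact: sqrtr_ge0.
have le_mu k : (\int[mu]_y (z y ^+ k.*2)%:E <= (A * B ^+ k.*2 * k.*2`!%:R)%:E)%E.
  by rewrite muz.
have le_nu k : (\int[nu]_y (z y ^+ k.*2)%:E <= (A * B ^+ k.*2 * k.*2`!%:R)%:E)%E.
  by rewrite nuz -eqm.
have c0 : 0 < (2 * B)^-1 by rewrite invr_gt0 mulr_gt0.
have exp_mu := integrable_expR_of_moments mu z A B z0 mz A0 B0 le_mu.
have exp_nu := integrable_expR_of_moments nu z A B z0 mz A0 B0 le_nu.
have int_z (P : probability R R) k :
    (\int[P]_y (z y ^+ k.*2)%:E <= (A * B ^+ k.*2 * k.*2`!%:R)%:E)%E ->
    P.-integrable setT (EFin \o (fun y => z y ^+ k.*2)).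
  move=> le_P; apply/integrableP; split.
    by apply/measurable_EFinP; exact: measurable_funX.
  apply: le_lt_trans (ltry _); apply: le_trans le_P; rewrite le_eqVlt.
  apply/orP; left; apply/eqP; apply: eq_integral => y _.
  by rewrite gee0_abs// lee_fin exprn_ge0.
have sz k : same_integral mu nu (fun y => z y ^+ k.*2).
  by split; [exact: int_z|exact: int_z|rewrite muz nuz eqm].
have scos := same_powers_cos mu nu z _ z0 c0 exp_mu exp_nu sz.
have rays a : mu `]a, +oo[%classic = nu `]a, +oo[%classic.
  have rayE : `]a, +oo[%classic = [set y : R | a < y].
    by apply/seteqP; split=> y /=; rewrite in_itv/= andbT.
  rewrite rayE -(measure_sqrt_gt mu _ mid mu0) -(measure_sqrt_gt nu _ mid nu0).
  apply: eq_measure_sqr_gt => //.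
  exact: measurable_set_gt (measurable_funX 2 mz).
move=> S mS.
refine (@measure_unique _ _ _ (@RGenOInfty.G R) (fun n => `]- n%:R, +oo[%classic)
  (RGenOInfty.measurableE R) _ _ _ mu nu _ _ S mS).
- move=> _ _ [a ->] [b ->]; exists (Num.max a b).
  by apply/seteqP; split=> y /=; rewrite !in_itv/= !andbT gt_max => /andP.
- by move=> n; exists (- n%:R).
- rewrite -subTset => y _; exists (Num.truncn `|y|).+1 => //=.
  by have := truncnS_gt `|y|; rewrite ltr_norml in_itv/= andbT => /andP[].
- by move=> _ [a ->]; exact: rays.
- by move=> n; rewrite (le_lt_trans (probability_le1 _ _)) ?ltry.
Qed.

Theorem theorem3 (d : measure_display) (T : measurableType d) (R : realType)
    (P : probability T R) (X : {RV P >-> R})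
    (X_ge0 : {ae P, forall w, 0 <= X w})
    (X_moments : forall k : nat, (1 <= k)%N -> moment X k \is a fin_num)
    (m1_gt0 : (0 < moment X 1)%E)
    (growth : (fun k : nat => (fine (moment X k.+1) / fine (moment X k) : R^o))
       =O_\oo (fun k : nat => (k.+1%:R ^+ 2 : R^o))) :
  hardy_condition X /\ m_det X.
Proof.
have mX : measurable_fun setT X by [].
have momentE k : moment X k = (\int[P]_w (X w ^+ k)%:E)%E by rewrite /moment unlock.
have sqrtE k := integral_sqrt_double P X mX X_ge0 k.
have moment0 : moment X 0 = 1%E.
  rewrite momentE; under eq_integral do rewrite expr0.
  by rewrite integral_cst//= probability_setT mule1.
have momentfin k : moment X k \is a fin_num.
  by case: k => [|k]; [rewrite moment0|exact: X_moments].
pose m k : R := fine (moment X k).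
have mE k : moment X k = (m k)%:E by rewrite fineK.
have m_ge0 k : 0 <= m k.
  rewrite -lee_fin -mE momentE -sqrtE; apply: integral_ge0 => w _.
  by rewrite lee_fin exprn_ge0.
have m_gt0 k : (0 < k)%N -> 0 < m k.
  move=> k0; rewrite lt_neqAle m_ge0 andbT eq_sym; apply/eqP => mk0.
  have : (\int[P]_w (Num.sqrt (X w) ^+ k.*2)%:E = 0)%E.
    by rewrite sqrtE -momentE mE mk0.
  move/(integral_sqrt_eq0 P X mX k k0)/(_ 1%N isT).
  by rewrite sqrtE -momentE => m10; rewrite m10 ltxx in m1_gt0.
have [C C0 [N _ mC]] := (eqO_exP _ _ _).1 growth.
(* Starting at [1] keeps the index in the range where [m_gt0] applies. *)
have m_growth k : (maxn N 1 <= k)%N -> m k.+1 <= C * k.+1%:R ^+ 2 * m k.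
  rewrite geq_max => /andP[Nk k1]; have := mC k Nk.
  rewrite /= [`|k.+1%:R ^+ 2|]ger0_norm ?sqr_ge0//.
  rewrite ger0_norm ?divr_ge0 ?m_ge0//.
  by rewrite ler_pdivrMr ?m_gt0.
have [A [B [A0 B0 m_le]]] :=
  factorial_bound_of_growth _ m C _ (ltW C0) m_ge0 m_growth.
have mom_le k : (moment X k <= (A * B ^+ k.*2 * k.*2`!%:R)%:E)%E.
  by rewrite mE lee_fin.
split.
- exists (2 * B)^-1; split; first by rewrite invr_gt0 mulr_gt0.
  have z_le k : (\int[P]_w (Num.sqrt (X w) ^+ k.*2)%:E <=
                 (A * B ^+ k.*2 * k.*2`!%:R)%:E)%E.
    by rewrite sqrtE -momentE.
  have /integrableP[_] := integrable_expR_of_moments P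
    (fun w => Num.sqrt (X w)) A B (fun w => sqrtr_ge0 _) (measurable_sqrt _ mX)
    A0 B0 z_le.
  apply: le_lt_trans; rewrite unlock le_eqVlt; apply/orP; left; apply/eqP.
  by apply: eq_integral => w _; rewrite gee0_abs// lee_fin expR_ge0.
- move=> nu nu1 num S mS; apply/esym.
  have X0 := ge0_ae_distribution _ _ _ P X X_ge0.
  have nu0 := ge0_ae_of_probability _ nu nu1.
  have lawE k : (\int[distribution P X]_y (y ^+ k)%:E = moment X k)%E.
    have mid : measurable_fun setT (fun y : R => y) by exact: measurable_id.
    rewrite -(integral_sqrt_double (distribution P X) _ mid X0) momentE -sqrtE.
    rewrite ge0_integral_distribution//.
    by apply/measurable_EFinP; apply: measurable_funX; exact: measurable_sqrt mid.
  apply: (eq_law_of_moments R (distribution P X) nu A B) => // k.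
    by rewrite lawE.
  rewrite lawE; case: k => [|k]; last by rewrite num.
  rewrite moment0; under eq_integral do rewrite expr0.
  by rewrite integral_cst//= probability_setT mule1.
Qed.
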